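(* Let $\mathcal{P}\subset\Delta(\mathcal{S})^{\mathcal{S}\times\mathcal{A}}$ be a nonempty compact uncertainty set, and let $r\in\mathbb{R}^{\mathcal{S}\times\mathcal{A}\times\mathcal{S}}$, $\gamma\in(0,1)$, $\mu\in\Delta(\mathcal{S})$. Assume that strong duality holds: $$\max_{\pi\in\Pi_{\mathsf S}}\min_{P\in\mathcal{P}}\mu^\top v^{\pi,P}=\min_{P\in\mathcal{P}}\max_{\pi\in\Pi_{\mathsf S}}\mu^\top v^{\pi,P}.$$ Then there exists a stationary optimal policy: $$\sup_{\pi\in\Pi_{\mathsf H}}\inf_{P\in\mathcal{P}}\mu^\top v^{\pi,P}=\max_{\pi\in\Pi_{\mathsf S}}\min_{P\in\mathcal{P}}\mu^\top v^{\pi,P}.$$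
   Context: $\mathcal{S}$ (states) and $\mathcal{A}$ (actions) are finite nonempty sets; $\Delta(E)$ denotes the set of probability distributions on a finite set $E$. Elements of an uncertainty set $\mathcal{P} \subset \Delta(\mathcal{S})^{\mathcal{S}\times\mathcal{A}}$ are written $P=(P_{sa})_{(s,a)}$ with $P_{sa}\in\Delta(\mathcal{S})$. $\Pi_{\mathsf H}$ is the set of history-dependent policies, i.e. maps from finite histories $(s_0,a_0,\dots,s_{t-1},a_{t-1},s_t)$, $t\ge 0$, to $\Delta(\mathcal{A})$; $\Pi_{\mathsf S}=\Delta(\mathcal{A})^{\mathcal{S}}\subset\Pi_{\mathsf H}$ is the set of stationary policies. For $\pi\in\Pi_{\mathsf H}$, $P\in\mathcal{P}$, the value function is $v^{\pi,P}_s=\mathbb{E}^{\pi,P}\big[\sum_{t\ge 0}\gamma^t r_{s_ta_ts_{t+1}}\,\big|\,s_0=s\big]$, where $a_t$ is drawn according to $\pi$ given the history and $s_{t+1}\sim P_{s_ta_t}$. *)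

(* Defs.v *)
From HB Require Import structures.
From mathcomp Require Import all_boot all_order all_algebra.
From mathcomp Require Import all_classical all_reals all_analysis.

Set Implicit Arguments.
Unset Strict Implicit.
Unset Printing Implicit Defensive.

Import Order.TTheory GRing.Theory Num.Theory.
Import numFieldNormedType.Exports.

Local Open Scope classical_set_scope.
Local Open Scope ring_scope.

(* Nonempty finite sets: the library's measurable types are pointed, so
   nonemptiness of the state and action sets is carried by a chosen point,
   which enters no value below except as a default. *)
#[short(type="finPointedType")]
HB.structure Definition FinPointed := {T of Finite T & Pointed T}.

(* The space R^((S x A) x S), with its product topology. *)
Notation kernel_space S A R := {ptws (S * A)%type -> {ptws S -> R}}.

Section mdp.
Context {S A : finPointedType} {R : realType}.

Definition prob_dist {E : finType} : set (E -> R) :=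
  [set p | (forall e, 0 <= p e) /\ \sum_e p e = 1].

Definition transition_kernels : set (kernel_space S A R) :=
  [set P | forall x, prob_dist (P x)].

(* [pi h s a] is the probability of action [a] after the history
   [(s_0, a_0), ..., (s_(t-1), a_(t-1)), s] with
   [h = [:: (s_0, a_0); ...; (s_(t-1), a_(t-1))]]. *)
Definition policy := seq (S * A) -> S -> A -> R.

Definition history_policies : set policy :=
  [set pi | forall h s, prob_dist (pi h s)].

Definition stationary_policies : set policy :=
  [set (fun=> sigma) | sigma in [set sigma : S -> A -> R |
                                  forall s, prob_dist (sigma s)]].

Definition cylinder (h : seq (S * A)) : set (nat -> S * A) :=
  [set w | mkseq w (size h) = h].

Definition trajectory := g_sigma_algebraType (range cylinder).

Section law.
Variables (pi : policy) (P : kernel_space S A R) (s : S).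

(* The distribution of the state following the state-action pairs [h]. *)
Definition next_state (h : seq (S * A)) (s' : S) : R :=
  if h is x :: h' then P (last x h') s' else (s' == s)%:R.

(* The probability that (s_t, a_t) is the t-th entry of [h] for all t < size h. *)
Definition path_prob (h : seq (S * A)) : R :=
  \prod_(t < size h)
    (next_state (take t h) (nth point h t).1 *
     pi (take t h) (nth point h t).1 (nth point h t).2).

Definition is_trajectory_law (mu : probability trajectory R) : Prop :=
  forall h, mu (cylinder h) = (path_prob h)%:E.

(* The law of ((s_t, a_t))_t given s_0 = s under [pi] and [P]; see
   [trajectory_lawP] and [trajectory_law_unique]. *)
Definition trajectory_law : probability trajectory R := get is_trajectory_law.

End law.

Definition discounted_return (r : S -> A -> S -> R) (gamma : R)
    (w : trajectory) : R :=
  limn (fun n => \sum_(0 <= t < n) gamma ^+ t * r (w t).1 (w t).2 (w t.+1).1).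

Definition value (r : S -> A -> S -> R) (gamma : R) (pi : policy)
    (P : kernel_space S A R) (s : S) : R :=
  fine 'E_(trajectory_law pi P s)[discounted_return r gamma].

Definition objective (r : S -> A -> S -> R) (gamma : R) (mu : S -> R)
    (pi : policy) (P : kernel_space S A R) : R :=
  \sum_s mu s * value r gamma pi P s.

End mdp.

Arguments prob_dist {R E}.
Arguments transition_kernels : clear implicits.
Arguments policy : clear implicits.
Arguments history_policies : clear implicits.
Arguments stationary_policies : clear implicits.
Arguments trajectory : clear implicits.

(* Existence and uniqueness of the trajectory law: a process with prescribed
   conditional distributions is realized on [0, 1[ with Lebesgue measure by
   splitting [0, 1[ into nested half-open intervals of length equal to the
   probability of each finite path. *)
Section construction.
Context {E : finType} {R : realType} (e0 : E) (q : seq E -> E -> R).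
Hypothesis q_dist : forall h, prob_dist (q h).

Let q_ge0 h e : 0 <= q h e. Proof. by have [+ _] := q_dist h; exact. Qed.
Let q_sum h : \sum_e q h e = 1. Proof. by have [_] := q_dist h. Qed.

Let weight h := \prod_(t < size h) q (take t h) (nth e0 h t).
Let cumN h n := \sum_(e | (enum_rank e < n)%N) q h e.
Let cum h (e : E) := cumN h (enum_rank e).
Let lo h := \sum_(t < size h) weight (take t h) * cum (take t h) (nth e0 h t).
Let cell h : set R := `[lo h, lo h + weight h[%classic.

Let weight_rcons h e : weight (rcons h e) = weight h * q h e.
Proof.
rewrite /weight size_rcons big_ord_recr/= nth_rcons ltnn eqxx -cats1.
rewrite take_size_cat//; congr (_ * _); apply: eq_bigr => t _.
by rewrite takel_cat ?nth_cat ?ltn_ord// ltnW.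
Qed.

Let lo_rcons h e : lo (rcons h e) = lo h + weight h * cum h e.
Proof.
rewrite /lo size_rcons big_ord_recr/= nth_rcons ltnn eqxx -cats1.
rewrite take_size_cat//; congr (_ + _); apply: eq_bigr => t _.
by rewrite takel_cat ?nth_cat ?ltn_ord// ltnW.
Qed.

Let weight_ge0 h : 0 <= weight h. Proof. exact: prodr_ge0. Qed.

Let cumNS h e : cumN h (enum_rank e).+1 = cum h e + q h e.
Proof.
rewrite /cum /cumN (bigD1 e)//= addrC; congr (_ + _); apply: eq_bigl => e'.
rewrite ltnS leq_eqVlt andbC; have [->|ne] := eqVneq e' e; first by rewrite ltnn.
case: eqP => //= /ord_inj/enum_rank_inj ee; by rewrite ee eqxx in ne.
Qed.

Let cumN_le h m n : (m <= n)%N -> cumN h m <= cumN h n.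
Proof.
move=> mn; rewrite /cumN big_mkcond [leRHS]big_mkcond ler_sum// => e _.
case: ifPn => [em|_]; first by rewrite (leq_trans em).
by case: ifPn.
Qed.

Let cell_ex h u : cell h u -> exists e, cell (rcons h e) u.
Proof.
rewrite /cell /= in_itv/= => /andP[lou uhi].
have cT : cumN h #|E| = 1.
  by rewrite -(q_sum h) /cumN; apply: eq_bigl => e; rewrite ltn_ord.
have c0 : cumN h 0 = 0 by rewrite /cumN big_pred0.
have ex : exists n, u < lo h + weight h * cumN h n.
  by exists #|E|; rewrite cT mulr1.
have := ex_minnP ex; case => -[|n] un nmin.
  by move: un; rewrite c0 mulr0 addr0 ltNge lou.
have nu : lo h + weight h * cumN h n <= u.
  by rewrite leNgt; apply/negP => /nmin; rewrite ltnn.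
have nE : (n < #|E|)%N.
  rewrite ltnNge; apply/negP => En; move: nu; rewrite leNgt (lt_le_trans uhi)//.
  by rewrite lerD2l ler_peMr// -cT cumN_le.
exists (enum_val (Ordinal nE)); rewrite in_itv/= lo_rcons weight_rcons.
by rewrite -addrA -mulrDr -cumNS /cum enum_valK nu un.
Qed.

Let cell_sub h e : cell (rcons h e) `<=` cell h.
Proof.
move=> u; rewrite /cell/= !in_itv/= lo_rcons weight_rcons -addrA -mulrDr -cumNS.
move=> /andP[a b]; apply/andP; split.
  by apply: le_trans a; rewrite lerDl mulr_ge0// sumr_ge0.
apply: lt_le_trans b _; rewrite lerD2l -[leRHS]mulr1 ler_wpM2l//.
rewrite -(q_sum h) /cumN big_mkcond ler_sum// => e' _.
by case: ifPn.
Qed.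

Let cell_inj h e e' u : cell (rcons h e) u -> cell (rcons h e') u -> e = e'.
Proof.
rewrite /cell/= !in_itv/= !lo_rcons !weight_rcons -!addrA -!mulrDr -!cumNS.
have lt_F (f g : E) : (enum_rank f < enum_rank g)%N ->
    u < lo h + weight h * cumN h (enum_rank f).+1 ->
    lo h + weight h * cum h g <= u -> False.
  move=> fg u1 u2; have := le_lt_trans u2 u1.
  by rewrite ltNge lerD2l ler_wpM2l// cumN_le.
move=> /andP[a b] /andP[c d].
have [ee'|e'e|/ord_inj/enum_rank_inj//] := ltngtP (enum_rank e) (enum_rank e').
- by case: (lt_F _ _ ee').
- by case: (lt_F _ _ e'e).
Qed.

Let next h (u : R) := xget e0 [set e | cell (rcons h e) u].
Let hist u := fix hist n :=
  if n is m.+1 then rcons (hist m) (next (hist m) u) else [::].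
Let path (u : R) n := if u \in `[0, 1[ then next (hist u n) u else e0.

Let size_hist u n : size (hist u n) = n.
Proof. by elim: n => //= n IH; rewrite size_rcons IH. Qed.

Let cell0 : cell [::] = `[0, 1[%classic :> set R.
Proof. by rewrite /cell /lo /weight /= !big_ord0 add0r. Qed.

Let cell01 h : cell h `<=` `[0, 1[%classic.
Proof.
elim/last_ind: h => [|h e IH]; first by rewrite cell0.
exact: subset_trans (@cell_sub _ _) IH.
Qed.

Let cell_hist u n : u \in `[0, 1[ -> cell (hist u n) u.
Proof.
move=> u01; elim: n => [|n IH] /=; first by rewrite cell0.
have [e ce] := cell_ex IH; rewrite /next.
by case: xgetP => [e' _ //|/(_ e)].
Qed.

Let cell_histE h u : cell h u -> hist u (size h) = h.
Proof.
elim/last_ind: h => [//|h e IH] hu.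
have := IH (cell_sub hu) => hh; rewrite size_rcons /= hh; congr rcons.
have u01 : u \in `[0, 1[ by have /= := cell01 hu.
have := cell_hist (size h).+1 u01; rewrite /= hh => k.
exact: cell_inj k hu.
Qed.

Let path_hist u n : u \in `[0, 1[ -> mkseq (path u) n = hist u n.
Proof.
move=> u01; elim: n => [//|n IH] /=; rewrite /mkseq -addn1 iotaD map_cat add0n.
by rewrite -/(mkseq _ _) IH /= {1}/path u01 cats1.
Qed.

Let path_cell u h : u \in `[0, 1[ -> mkseq (path u) (size h) = h <-> cell h u.
Proof.
move=> u01; rewrite path_hist//; split; last exact: cell_histE.
by move=> <-; exact: cell_hist.
Qed.

Let lebesgue_cell h : lebesgue_measure (cell h) = (weight h)%:E.
Proof.
rewrite /cell lebesgue_measure_itv/= lte_fin ltrDl lt_neqAle eq_sym weight_ge0.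
rewrite andbT; case: eqP => [->//|_]; by rewrite -EFinD addrAC subrr add0r.
Qed.

Lemma process_exists : exists X : R -> nat -> E,
  [/\ forall h, measurable [set u | mkseq (X u) (size h) = h] &
      forall h, lebesgue_measure
        ([set u | mkseq (X u) (size h) = h] `&` `[0, 1[%classic) =
        (\prod_(t < size h) q (take t h) (nth e0 h t))%:E].
Proof.
have E1 h : [set u | mkseq (path u) (size h) = h] `&` `[0, 1[%classic = cell h.
  apply/seteqP; split => u /=; first by case => + u01; rewrite path_cell.
  by move=> hu; have u01 := cell01 hu; split => //; rewrite path_cell.
exists path; split => h; last by rewrite E1 lebesgue_cell.
rewrite -[X in measurable X]setIT -(setvU `[0, 1[%classic) setIUr E1.
apply: measurableU; last exact: measurable_itv.
have -> : [set u | mkseq (path u) (size h) = h] `&` ~` `[0, 1[%classic =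
    if mkseq (fun=> e0) (size h) == h then ~` `[0, 1[%classic else set0.
  apply/seteqP; split => u /=.
    move=> [+ /negP nu]; rewrite /path (negbTE nu) => ->; rewrite eqxx.
    exact/negP.
  by case: eqP => // + /negP nu; rewrite /path (negbTE nu).
by case: ifP => // _; apply: measurableC; exact: measurable_itv.
Qed.

End construction.

Section law_theory.
Context {S A : finPointedType} {R : realType}.

Let measurable_cylinder (h : seq (S * A)) :
  measurable (cylinder h : set (trajectory S A)).
Proof. by apply: sub_sigma_algebra; exists h. Qed.

Lemma trajectory_law_exists (pi : policy S A R) (P : kernel_space S A R) (s : S) :
  history_policies S A R pi -> transition_kernels S A R P ->
  exists mu : probability (trajectory S A) R, is_trajectory_law pi P s mu.
Proof.
move=> Hpi HP.
pose q h (x : S * A) := next_state P s h x.1 * pi h x.1 x.2.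
have nd h : prob_dist (next_state P s h).
  case: h => [|x h]; last exact: HP.
  split=> [s'|]; first by rewrite /= ler0n.
  by rewrite /= (bigD1 s)//= eqxx big1 ?addr0// => i /negbTE ->.
have qd h : prob_dist (q h).
  split=> [x|].
    by rewrite mulr_ge0//; [have [+ _] := nd h|have [+ _] := Hpi h x.1]; exact.
  rewrite -(pair_bigA _ (fun s a => next_state P _ h s * pi h s a))/=.
  have [_ <-] := nd h; apply: eq_bigr => s' _.
  by rewrite -big_distrr/=; have [_ ->] := Hpi h s'; rewrite mulr1.
have [X [mX lX]] := @process_exists (S * A)%type R point q qd.
have mX' : measurable_fun setT (X : measurableTypeR R -> trajectory S A).
  apply: (@measurability _ _ _ (trajectory S A) _ _ (range (@cylinder S A))) => //.
  by move=> _ [_ [h _ <-] <-]; rewrite setTI; exact: mX.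
pose D : set R := `[0, 1[%classic.
have mD : measurable D by exact: measurable_itv.
have DT : mrestr lebesgue_measure mD [set: R] = 1%E.
  by rewrite /mrestr setTI /D lebesgue_measure_itv/= lte_fin ltr01 oppr0 adde0.
pose P0 : probability (measurableTypeR R) R :=
  mnormalize (mrestr lebesgue_measure mD) point.
have P0E B : P0 B = lebesgue_measure (B `&` D).
  rewrite /P0 /= /mnormalize.
  set x := (X in (X == 0%E) || _); have x1 : x = 1%E by exact: DT.
  rewrite x1 onee_eq0 /=; set y := (X in fine X); have -> : y = 1%E by exact: DT.
  rewrite /= invr1; case: ifP => [|_]; last exact: mule1.
  set z := (X in X == _); have -> : z = 1%E by exact: DT.
  by [].

pose XM := isMeasurableFun.Build _ _ (measurableTypeR R) _ (X : R -> trajectory S A) mX'.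
pose X' : {mfun measurableTypeR R >-> trajectory S A} := HB.pack (X : measurableTypeR R -> trajectory S A) XM.
exists (distribution P0 X') => h.
by rewrite /= /distribution /pushforward P0E; exact: lX.
Qed.

Lemma trajectory_lawP (pi : policy S A R) (P : kernel_space S A R) (s : S) :
  history_policies S A R pi -> transition_kernels S A R P ->
  is_trajectory_law pi P s (trajectory_law pi P s).
Proof. by move=> Hpi HP; apply: getPex; exact: trajectory_law_exists. Qed.

Lemma trajectory_law_unique (pi : policy S A R) (P : kernel_space S A R) (s : S)
    (mu nu : probability (trajectory S A) R) :
  is_trajectory_law pi P s mu -> is_trajectory_law pi P s nu ->
  forall B, measurable B -> mu B = nu B.
Proof.
move=> Hmu Hnu; pose G := set0 |` range (@cylinder S A).
have Gm : G `<=` (measurable : set (set (trajectory S A))).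
  by move=> _ [->|[h _ <-]] //; exact: measurable_cylinder.
have setIG : setI_closed G.
  move=> B C [->|[h _ <-]]; first by rewrite set0I; left.
  case=> [->|[k _ <-]]; first by rewrite setI0; left.
  wlog hk : h k / (size h <= size k)%N => [W|].
    have [/W//|/ltnW/W] := leqP (size h) (size k).
    by rewrite setIC.
  have tk (w : nat -> S * A) : mkseq w (size k) = k -> mkseq w (size h) = take (size h) k.
    move=> kw; rewrite -[in RHS]kw /mkseq -map_take take_iota.
    by rewrite (minn_idPl hk).
  have [e|ne] := eqVneq (take (size h) k) h.
    right; exists k => //; apply/seteqP; split=> w /=; last by case.
    by move=> kw; split=> //; rewrite /cylinder /= (tk _ kw).
  left; apply/seteqP; split=> w //= -[hw /tk kw].
  by move: ne; rewrite -kw hw eqxx.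
have sG : <<s range (@cylinder S A) >> `<=` <<s G >>.
  by apply: sub_sigma_algebra2 => C ?; right.
move=> B mB.
apply: (@g_sigma_algebra_measure_unique _ _ (trajectory S A) G Gm (fun=> setT) _ _ mu nu) => //.
- by move=> _; right; exists [::] => //; apply/seteqP; split.
- by rewrite bigcup_const.
- move=> C [->|[h _ <-]]; first by rewrite !measure0.
  exact: etrans (Hmu h) (esym (Hnu h)).
- by move=> _; exact: le_lt_trans (probability_le1 mu measurableT) (ltry 1).
- by exact: sG.
Qed.
End law_theory.

(* [is_max_min] asserts that the inner minima and the outer maximum are
   attained; [sup_inf] and [inf_sup] assert nothing about attainment. *)
Section optimization.
Context {X Y : Type} {R : realType}.

Definition is_min (V : set Y) (g : Y -> R) (m : R) : Prop :=
  (exists2 y, V y & g y = m) /\ (forall y, V y -> m <= g y).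

Definition is_max (U : set X) (g : X -> R) (m : R) : Prop :=
  (exists2 x, U x & g x = m) /\ (forall x, U x -> g x <= m).

Definition is_max_min (U : set X) (V : set Y) (f : X -> Y -> R) (c : R) : Prop :=
  exists2 g : X -> R, (forall x, U x -> is_min V (f x) (g x)) & is_max U g c.

Definition sup_inf (U : set X) (V : set Y) (f : X -> Y -> R) : \bar R :=
  ereal_sup [set ereal_inf [set (f x y)%:E | y in V] | x in U].

Definition inf_sup (U : set X) (V : set Y) (f : X -> Y -> R) : \bar R :=
  ereal_inf [set ereal_sup [set (f x y)%:E | x in U] | y in V].

End optimization.

(* Main.v *)
From HB Require Import structures.
Require Import Defs.
From mathcomp Require Import all_boot all_order all_algebra.
From mathcomp Require Import all_classical all_reals all_analysis.
From mathcomp Require Import measurable_realfun.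
From mathcomp Require Import ring lra.

Set Implicit Arguments.
Unset Strict Implicit.
Unset Printing Implicit Defensive.

Import Order.TTheory GRing.Theory Num.Theory.
Import numFieldNormedType.Exports.

Local Open Scope classical_set_scope.
Local Open Scope ring_scope.

(** Weak duality gives sup_inf <= inf_sup for history-dependent policies.  For a
    fixed kernel [P] one faces an ordinary Markov decision process, in which some
    stationary policy is at least as good as every history-dependent one, so
    inf_sup does not change when history-dependent policies are replaced by
    stationary ones; by the strong duality hypothesis it equals the stationary
    sup_inf.  Conversely stationary policies are history-dependent, so all these
    quantities coincide with the stationary max-min, provided that its extrema
    are attained.

    Both the optimality of stationary policies and the attainment rest on one
    verification principle ([value_le], [value_ge]): if one backup step never
    raises (never lowers) a function [w] of the state, then [w] bounds the value
    from above (below).  To see this, stop collecting rewards at time [n] and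
    collect [w s_n], discounted, instead; the expectation of this bootstrapped return
    is [w s] for [n = 0], tends to the value, and changes from [n] to [n + 1] by
    [gamma ^+ n] times the expected difference between the backup of [w] and [w]
    ([path_avg_bootstrapped_step]).

    - A stationary policy has a value that is fixed by its backup
      ([value_backup]): a fixed point exists since backup is affine and the
      homogeneous equation has only the null solution, and any fixed point is
      the value by verification.
    - Among the finitely many deterministic stationary policies take one with
      the largest total value.  A greedy policy for its value cannot
      improve it, so its value is fixed by the greedy backup and dominates the
      value of every history-dependent policy ([exists_optimal_deterministic]).
    - If a small change of the kernel or of the stationary policy moves the
      backup of the old value by at most [(1 - gamma) * eps], the value moves by
      at most [eps].  Hence the objective is lower semicontinuous in the kernel
      and upper semicontinuous in the stationary policy, and compactness of the
      uncertainty set and of the set of stationary policies yields the minima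
      and the maximum. *)

(** * Averages over finite paths *)

Lemma big_tuple_rcons {V : nmodType} {T : finType} n (F : seq T -> V) :
  \sum_(h : n.+1.-tuple T) F h = \sum_(h : n.-tuple T) \sum_x F (rcons h x).
Proof.
rewrite pair_bigA /=.
rewrite (reindex (fun p : n.-tuple T * T => [tuple of rcons p.1 p.2])) //=.
exists (fun t : n.+1.-tuple T => ([tuple of belast (thead t) (behead t)],
                                  last (thead t) (behead t))).
  move=> [h x] _ /=; rewrite /thead (tnth_nth x)/=; congr pair.
    by apply: val_inj; case: h => -[|y h] //= _; rewrite belast_rcons.
  by case: h => -[|y h] //= _; rewrite last_rcons.
by move=> t _; apply: val_inj => /=; rewrite -lastI; case/tupleP: t.
Qed.

Lemma big_pair {V : nmodType} {T T' : finType} (F : T * T' -> V) :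
  \sum_x F x = \sum_t \sum_t' F (t, t').
Proof. by rewrite pair_bigA; apply: eq_bigr => -[]. Qed.

Section path_average.
Context {S A : finPointedType} {R : realType}.
Variables (pi : policy S A R) (P : kernel_space S A R) (s : S).
Implicit Types (h : seq (S * A)) (f g : seq (S * A) -> R).

Lemma path_prob_rcons h x :
  path_prob pi P s (rcons h x) =
  path_prob pi P s h * (next_state P s h x.1 * pi h x.1 x.2).
Proof.
rewrite /path_prob size_rcons big_ord_recr/= nth_rcons ltnn eqxx -cats1.
rewrite take_size_cat//; congr (_ * _); apply: eq_bigr => t _.
by rewrite takel_cat ?nth_cat ?ltn_ord// ltnW.
Qed.

(** The expectation of [f] at the first [n] state-action pairs of the trajectory
    ([integral_mkseq]). *)
Definition path_avg n f : R :=
  \sum_(h : n.-tuple (S * A)) path_prob pi P s h * f h.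

Lemma path_avg0 f : path_avg 0 f = f [::].
Proof.
rewrite /path_avg (bigD1 [tuple])//= big1 ?addr0 => [|h]; last by rewrite tuple0.
by rewrite /path_prob big_ord0 mul1r.
Qed.

(** Tower property: condition on the first [n] pairs, then average over the next
    state and the action chosen there. *)
Lemma path_avgS n f :
  path_avg n.+1 f =
  path_avg n (fun h => \sum_s' next_state P s h s' *
                         \sum_a pi h s' a * f (rcons h (s', a))).
Proof.
rewrite /path_avg (big_tuple_rcons _ (fun h => path_prob pi P s h * f h)).
apply: eq_bigr => h _.
rewrite big_pair mulr_sumr; apply: eq_bigr => s' _; rewrite !mulr_sumr.
by apply: eq_bigr => a _; rewrite path_prob_rcons/= !mulrA.
Qed.

Lemma path_avgB n f g :
  path_avg n (fun h => f h - g h) = path_avg n f - path_avg n g.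
Proof. by rewrite /path_avg -sumrB; apply: eq_bigr => h _; rewrite mulrBr. Qed.

Lemma path_avgZ n c f : path_avg n (fun h => c * f h) = c * path_avg n f.
Proof. by rewrite /path_avg mulr_sumr; apply: eq_bigr => h _; rewrite mulrCA. Qed.

Hypothesis Hpi : history_policies S A R pi.
Hypothesis HP : transition_kernels S A R P.

Lemma next_state_dist h : prob_dist (next_state P s h).
Proof.
case: h => [|x h]; last exact: HP.
split=> [s'|]; first by rewrite /= ler0n.
by rewrite /= (bigD1 s)//= eqxx big1 ?addr0// => i /negbTE ->.
Qed.

Lemma path_prob_ge0 h : 0 <= path_prob pi P s h.
Proof.
apply: prodr_ge0 => t _; apply: mulr_ge0.
  by have [+ _] := next_state_dist (take t h).
by have [+ _] := Hpi (take t h) (nth point h t).1.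
Qed.

Lemma path_avg_ge0 n f : (forall h, 0 <= f h) -> 0 <= path_avg n f.
Proof. by move=> f0; apply: sumr_ge0 => h _; rewrite mulr_ge0 ?path_prob_ge0. Qed.

Lemma cylinder_measurable h : measurable (cylinder h : set (trajectory S A)).
Proof. by apply: sub_sigma_algebra; exists h. Qed.

Lemma cylinder_sum n f (w : trajectory S A) :
  f (mkseq w n) =
  \sum_(h : n.-tuple (S * A)) f h * \1_(cylinder h : set (trajectory S A)) w.
Proof.
have sw : size (mkseq w n) == n by rewrite size_mkseq.
rewrite (bigD1 (Tuple sw))//= big1 ?addr0 => [|h nh].
  by rewrite indicE mem_set ?mulr1// /cylinder/= size_mkseq.
rewrite indicE memNset ?mulr0// /cylinder /= size_tuple => wh.
by move/eqP: nh; apply; apply: val_inj.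
Qed.

Lemma measurable_mkseq n f :
  measurable_fun setT (fun w : trajectory S A => f (mkseq w n)).
Proof.
rewrite (funext (cylinder_sum n f)).
apply: measurable_sum => h; apply: measurable_funM => //.
apply: measurable_indic; exact: cylinder_measurable.
Qed.

Lemma integral_mkseq n f :
  (\int[trajectory_law pi P s]_w (f (mkseq w n))%:E)%E = (path_avg n f)%:E.
Proof.
have mc h := @cylinder_measurable h.
under eq_integral do rewrite cylinder_sum -sumEFin.
rewrite integral_sum//=; last first.
  move=> h; rewrite (_ : (fun w => _) = (fun w =>
    (f h)%:E * (\1_(cylinder h : set (trajectory S A)) w)%:E)%E)//.
  by apply: integrableZl => //; apply: integrable_indic.
rewrite /path_avg -sumEFin; apply: eq_bigr => h _.
under eq_integral do rewrite EFinM.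
rewrite integralZl//; last exact: integrable_indic.
rewrite integral_indic// setIT muleC.
by rewrite [X in (X * _)%E](trajectory_lawP s Hpi HP h).
Qed.

End path_average.

(** * The verification principle *)

Definition backup {S A : finPointedType} {R : realType}
    (r : S -> A -> S -> R) (gamma : R) (P : kernel_space S A R)
    (p : A -> R) (w : S -> R) (s : S) : R :=
  \sum_a p a * \sum_s' P (s, a) s' * (r s a s' + gamma * w s').

Section verification.
Context {S A : finPointedType} {R : realType}.
Variables (r : S -> A -> S -> R) (gamma : R).
Hypothesis gamma01 : 0 < gamma < 1.
Variables (pi : policy S A R) (P : kernel_space S A R).
Hypothesis Hpi : history_policies S A R pi.
Hypothesis HP : transition_kernels S A R P.
Variable w : S -> R.

Let gamma_ge0 : 0 <= gamma. Proof. by case/andP: gamma01 => /ltW. Qed.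
Let gamma_lt1 : gamma < 1. Proof. by case/andP: gamma01. Qed.

(** The rewards of the first [n] steps involve the states up to time [n], so [h]
    is meant to have length [n.+1]; from time [n] on, [w] stands for the
    remaining return. *)
Definition bootstrapped_return n (h : seq (S * A)) : R :=
  \sum_(t < n) gamma ^+ t *
     r (nth point h t).1 (nth point h t).2 (nth point h t.+1).1 +
  gamma ^+ n * w (nth point h n).1.

Lemma next_state_rcons s h x s' : next_state P s (rcons h x) s' = P x s'.
Proof. by case: h => [|y h] //=; rewrite last_rcons. Qed.

(** The two returns differ only in that [w s_n] is replaced by the reward of step
    [n] plus [gamma * w s_(n+1)]; averaging over [s_(n+1)] and then over [a_n]
    turns the replacement into a backup of [w]. *)
Lemma path_avg_bootstrapped_step n s :
  path_avg pi P s n.+2 (bootstrapped_return n.+1) -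
  path_avg pi P s n.+1 (bootstrapped_return n) =
  gamma ^+ n * path_avg pi P s n (fun h =>
     \sum_s' next_state P s h s' * (backup r gamma P (pi h s') w s' - w s')).
Proof.
have next1 h : \sum_s' next_state P s h s' = 1.
  by have [] := next_state_dist s HP h.
have pi1 h s' : \sum_a pi h s' a = 1 by have [] := Hpi h s'.
pose D (h : seq (S * A)) := \sum_s' next_state P s h s' *
  (r (nth point h n).1 (nth point h n).2 s' + gamma * w s') - w (nth point h n).1.
rewrite path_avgS -path_avgB -path_avgZ.
rewrite (_ : path_avg _ _ _ _ _ =
    path_avg pi P s n.+1 (fun h => gamma ^+ n * D h)).
  rewrite path_avgS; apply: eq_bigr => h _; congr (_ * _); rewrite mulr_sumr.
  apply: eq_bigr => s' _; rewrite mulrCA; congr (_ * _).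
  rewrite /backup -[X in _ - X]mul1r -(pi1 h s') mulr_suml -sumrB mulr_sumr.
  apply: eq_bigr => a _; rewrite mulrCA -mulrBr; congr (_ * (_ * _)).
  rewrite /D; under eq_bigr do rewrite next_state_rcons.
  by rewrite nth_rcons size_tuple ltnn eqxx.
apply: eq_bigr => h _; congr (_ * _).
have nthE x t : (t < n.+1)%N -> nth point (rcons h x) t = nth point h t.
  by move=> tn; rewrite nth_rcons size_tuple tn.
have lastE x : nth point (rcons h x) n.+1 = x.
  by rewrite nth_rcons size_tuple ltnn eqxx.
pose B := \sum_(t < n) gamma ^+ t *
  r (nth point h t).1 (nth point h t).2 (nth point h t.+1).1.
have stepE x : bootstrapped_return n.+1 (rcons h x) =
    B + gamma ^+ n * (r (nth point h n).1 (nth point h n).2 x.1 + gamma * w x.1).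
  rewrite /bootstrapped_return big_ord_recr/= lastE nthE// exprSr -mulrA -addrA.
  rewrite mulrDr; congr (_ + _).
  apply: eq_bigr => t _; rewrite !nthE// ltnS//; exact: ltnW.
(* The bootstrapped return does not involve the last action, whose
   probabilities therefore sum out. *)
under eq_bigr => s' _ do
  [under eq_bigr => a _ do rewrite stepE/=; rewrite -mulr_suml pi1 mul1r mulrDr].
rewrite big_split/= -mulr_suml next1 mul1r /bootstrapped_return -/B /D.
rewrite mulrBr opprD addrACA subrr add0r; congr (_ - _).
by rewrite mulr_sumr; apply: eq_bigr => s' _; rewrite mulrCA.
Qed.

Lemma path_avg_bootstrapped0 s : path_avg pi P s 1 (bootstrapped_return 0) = w s.
Proof.
rewrite path_avgS path_avg0 (bigD1 s)//= eqxx mul1r [X in _ + X]big1 ?addr0.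
  under eq_bigr do rewrite /bootstrapped_return big_ord0 add0r expr0 mul1r/=.
  by rewrite -mulr_suml; have [_ ->] := Hpi [::] s; rewrite mul1r.
by move=> s' /negbTE ->; rewrite mul0r.
Qed.

Let rmax : R := \sum_s \sum_a \sum_s' `|r s a s'|.
Let wmax : R := \sum_s `|w s|.

Let r_le s a s' : `|r s a s'| <= rmax.
Proof.
rewrite /rmax (bigD1 s)//= (bigD1 a)//= (bigD1 s')//= -!addrA lerDl.
by rewrite !addr_ge0//; repeat (apply: sumr_ge0 => ? _).
Qed.

Let w_le s : `|w s| <= wmax.
Proof. by rewrite /wmax (bigD1 s)//= lerDl sumr_ge0. Qed.

Lemma bootstrapped_return_bounded n h :
  `|bootstrapped_return n h| <= rmax / (1 - gamma) + wmax.
Proof.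
have g1 : 0 < 1 - gamma by rewrite subr_gt0.
have rmax0 : 0 <= rmax by exact: le_trans (r_le point point point).
apply: le_trans (ler_normD _ _) _; apply: lerD.
  apply: le_trans (ler_norm_sum _ _ _) _.
  apply: (@le_trans _ _ (\sum_(t < n) rmax * gamma ^+ t)).
    apply: ler_sum => t _; rewrite normrM ger0_norm ?exprn_ge0// mulrC.
    by rewrite ler_wpM2r ?exprn_ge0// r_le.
  rewrite -mulr_sumr ler_wpM2l// -[leRHS]mul1r ler_pdivlMr// mulrC.
  by rewrite -opprB mulNr -subrX1 opprB lerBlDr lerDl exprn_ge0.
rewrite normrM ger0_norm ?exprn_ge0//.
apply: le_trans (w_le (nth point h n).1).
by rewrite ler_piMl// exprn_ile1// ltW.
Qed.

Lemma bootstrapped_return_cvg (o : trajectory S A) :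
  bootstrapped_return n (mkseq o n.+1) @[n --> \oo] -->
  discounted_return r gamma o.
Proof.
pose u t := gamma ^+ t * r (o t).1 (o t).2 (o t.+1).1.
have gn : `|gamma| < 1 by rewrite ger0_norm.
have cu : cvgn (series u).
  apply: normed_cvg; apply: (@series_le_cvg _ _ (geometric rmax gamma)).
  - by move=> n /=.
  - move=> n; rewrite /geometric/= mulr_ge0 ?exprn_ge0//.
    exact: le_trans (r_le point point point).
  - move=> n /=; rewrite /u normrM ger0_norm ?exprn_ge0// mulrC.
    by rewrite ler_wpM2r ?exprn_ge0// r_le.
  - exact: is_cvg_geometric_series.
rewrite (_ : (fun n => _) =
    (fun n => series u n + gamma ^+ n * w (o n).1)); last first.
  have nthE n t : (t <= n)%N -> nth point (mkseq o n.+1) t = o t.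
    by move=> tn; rewrite nth_mkseq.
  apply/funext => n; rewrite /bootstrapped_return seriesEord nthE//.
  congr (_ + _).
  by apply: eq_bigr => t _; rewrite !nthE// ltnW.
rewrite -[X in _ --> X]addr0; apply: cvgD; first exact: cu.
apply/norm_cvg0P; apply: (@squeeze_cvgr _ _ _ _ (cst 0) (geometric wmax gamma)).
- apply: nearW => n /=; rewrite normr_ge0 normrM ger0_norm ?exprn_ge0// mulrC.
  by rewrite ler_wpM2r ?exprn_ge0// w_le.
- exact: cvg_cst.
- exact: cvg_geometric.
Qed.

(** Dominated convergence: the returns are bounded by a geometric series. *)
Lemma value_cvg s :
  path_avg pi P s n.+1 (bootstrapped_return n) @[n --> \oo] -->
  value r gamma pi P s.
Proof.
pose m := trajectory_law pi P s.
pose K := rmax / (1 - gamma) + wmax.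
pose F n (o : trajectory S A) := (bootstrapped_return n (mkseq o n.+1))%:E.
pose f (o : trajectory S A) := (discounted_return r gamma o)%:E.
have mF n : measurable_fun setT (F n).
  apply/measurable_EFinP.
  exact: (measurable_mkseq n.+1 (bootstrapped_return n)).
have Ff o : F n o @[n --> \oo] --> f o.
  by apply: cvg_EFin; [exact: nearW|exact: bootstrapped_return_cvg].
have mf : measurable_fun setT f by apply: (emeasurable_fun_cvg F).
have iK : m.-integrable setT (EFin \o cst K).
  exact: finite_measure_integrable_cst.
have [||fint _ FE] :=
  @dominated_convergence _ _ _ m setT measurableT F f _ mF mf _ iK _.
- by apply: aeW => o _; exact: Ff.
- by apply: aeW => o n _; rewrite /= lee_fin bootstrapped_return_bounded.
have fE := integrable_fin_num measurableT fint.
rewrite /value unlock -/m -/f.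
apply: (@fine_cvg _ _ _ _
  (fun n => (path_avg pi P s n.+1 (bootstrapped_return n))%:E)).
rewrite fineK//; apply: cvg_trans FE; apply: near_eq_cvg; apply: nearW => n /=.
by rewrite /F (integral_mkseq s Hpi HP).
Qed.

Lemma value_le s : (forall h s', backup r gamma P (pi h s') w s' <= w s') ->
  value r gamma pi P s <= w s.
Proof.
move=> ww.
have le n : path_avg pi P s n.+1 (bootstrapped_return n) <= w s.
  elim: n => [|n IH]; first by rewrite path_avg_bootstrapped0.
  apply: le_trans IH; rewrite -subr_le0 path_avg_bootstrapped_step.
  rewrite -oppr_ge0 -mulrN mulr_ge0 ?exprn_ge0//.
  rewrite -[X in 0 <= X]mulN1r -path_avgZ; apply: path_avg_ge0 => // h.
  rewrite mulN1r -sumrN; apply: sumr_ge0 => s' _; rewrite -mulrN mulr_ge0//.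
    by have [+ _] := next_state_dist s HP h.
  by rewrite oppr_ge0 subr_le0.
apply: cvgr_to_le (@value_cvg s) _.
exact: nearW.
Qed.

Lemma value_ge s : (forall h s', w s' <= backup r gamma P (pi h s') w s') ->
  w s <= value r gamma pi P s.
Proof.
move=> ww.
have ge n : w s <= path_avg pi P s n.+1 (bootstrapped_return n).
  elim: n => [|n IH]; first by rewrite path_avg_bootstrapped0.
  apply: le_trans IH _; rewrite -subr_ge0 path_avg_bootstrapped_step.
  rewrite mulr_ge0 ?exprn_ge0//.
  apply: path_avg_ge0 => // h.
  apply: sumr_ge0 => s' _; rewrite mulr_ge0//.
    by have [+ _] := next_state_dist s HP h.
  by rewrite subr_ge0.
apply: cvgr_to_ge (@value_cvg s) _.
exact: nearW.
Qed.

End verification.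

(** * Stationary policies *)

Section stationary.
Context {S A : finPointedType} {R : realType}.
Variable gamma : R.
Hypothesis gamma01 : 0 < gamma < 1.
Implicit Types (r : S -> A -> S -> R) (P : kernel_space S A R).
Implicit Types (sigma : S -> A -> R) (p : A -> R) (v w : S -> R).

Lemma stationary_history sigma : (forall s, prob_dist (sigma s)) ->
  history_policies S A R (fun=> sigma).
Proof. by move=> Hs h s; exact: Hs. Qed.

Lemma value_stationary_eq r P sigma v :
  transition_kernels S A R P -> (forall s, prob_dist (sigma s)) ->
  (forall s, backup r gamma P (sigma s) v s = v s) ->
  forall s, value r gamma (fun=> sigma) P s = v s.
Proof.
move=> HP Hs fixv s; have Hpi := stationary_history Hs; apply/le_anti/andP; split.
  by apply: value_le => // h s'; rewrite fixv.
by apply: value_ge => // h s'; rewrite fixv.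
Qed.

Let zero_reward : S -> A -> S -> R := fun _ _ _ => 0.

Lemma backup_linear P p s (c : R) (u v : S -> R) :
  backup zero_reward gamma P p (fun s => c * u s + v s) s =
  c * backup zero_reward gamma P p u s + backup zero_reward gamma P p v s.
Proof.
rewrite /backup /zero_reward mulr_sumr -[RHS]big_split; apply: eq_bigr => a _ /=.
rewrite [c * _]mulrCA -mulrDr; congr (_ * _); rewrite mulr_sumr -[RHS]big_split.
by apply: eq_bigr => s' _ /=; ring.
Qed.

Lemma backup_affine r P p s v :
  backup r gamma P p v s =
  backup r gamma P p (fun=> 0) s + backup zero_reward gamma P p v s.
Proof.
rewrite /backup /zero_reward -[RHS]big_split; apply: eq_bigr => a _ /=.
rewrite -mulrDr; congr (_ * _); rewrite -[RHS]big_split.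
by apply: eq_bigr => s' _ /=; ring.
Qed.

(** The map sending [u] to [u] minus its backup for the null reward is linear on a finite-dimensional space, and
    injective: an element of its kernel is the value of the policy for the null
    reward, and so is the null function.  Hence it is onto. *)
Lemma backup_fixpoint r P sigma :
  transition_kernels S A R P -> (forall s, prob_dist (sigma s)) ->
  exists v, forall s, backup r gamma P (sigma s) v s = v s.
Proof.
move=> HP Hs.
pose V : vectType R := {ffun S -> R^o}.
pose f (u : V) : V := [ffun s => u s - backup zero_reward gamma P (sigma s) u s].
have flin : linear f.
  move=> c u v; apply/ffunP => s; rewrite !ffunE.
  rewrite (_ : backup _ _ _ _ (c *: u + v) s =
    c * backup zero_reward gamma P (sigma s) u s +
    backup zero_reward gamma P (sigma s) v s); last first.
    rewrite -backup_linear; congr (backup _ _ _ _ _ _).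
    by apply/funext => s'; rewrite !ffunE.
  by rewrite /GRing.scale /=; ring.
pose F : {linear V -> V} := HB.pack f (GRing.isLinear.Build R V V *:%R f flin).
have kerF : lker (linfun F) == 0%VS.
  rewrite -subv0; apply/subvP => u; rewrite memv_ker lfunE/= memv0 => /eqP fu0.
  apply/eqP/ffunP => s; rewrite [RHS]ffunE.
  rewrite -(@value_stationary_eq zero_reward P sigma u HP Hs).
    apply: (@value_stationary_eq zero_reward P sigma (fun=> 0)) => // s'.
    rewrite /backup big1// => a _; rewrite big1 ?mulr0// => s'' _.
    by rewrite /zero_reward addr0 mulr0.
  move=> s'; apply/esym/eqP; rewrite -subr_eq0.
  by have /ffunP/(_ s') := fu0; rewrite !ffunE => ->.
pose b : V := [ffun s => backup r gamma P (sigma s) (fun=> 0) s].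
exists ((linfun F)^-1%VF b) => s.
have /ffunP/(_ s) := lker0_lfunVK kerF b.
by rewrite lfunE/= !ffunE => E; rewrite backup_affine -E subrK.
Qed.

Lemma value_backup r P sigma s :
  transition_kernels S A R P -> (forall s, prob_dist (sigma s)) ->
  backup r gamma P (sigma s) (value r gamma (fun=> sigma) P) s =
  value r gamma (fun=> sigma) P s.
Proof.
move=> HP Hs; have [v fixv] := backup_fixpoint r HP Hs.
rewrite (_ : value _ _ _ _ = v) ?fixv//.
by apply/funext; exact: value_stationary_eq.
Qed.

Definition deterministic (d : S -> A) : S -> A -> R := fun s a => (a == d s)%:R.

Lemma deterministic_dist d s : prob_dist (deterministic d s).
Proof.
split=> [a|]; first by rewrite /deterministic ler0n.
by rewrite /deterministic (bigD1 (d s))//= eqxx big1 ?addr0// => a /negbTE ->.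
Qed.

(** Policy improvement.  The sum of the values over all states turns the
    comparison of policies, whose values are ordered only pointwise, into a
    comparison of numbers, so that a best one exists among finitely many. *)
Lemma exists_optimal_deterministic r P : transition_kernels S A R P ->
  exists d, forall pi s, history_policies S A R pi ->
    value r gamma pi P s <= value r gamma (fun=> deterministic d) P s.
Proof.
move=> HP.
pose val (d : {ffun S -> A}) := value r gamma (fun=> deterministic d) P.
pose d0 : {ffun S -> A} := [ffun=> point].
have [d _ dmax] := @arg_maxP _ _ _ d0 predT (fun d => \sum_s val d s) isT.
have dbk s := value_backup r s HP (deterministic_dist d).
exists d => pi s Hpi; apply: value_le => // h s'.
(* [q s a] is the value of playing [a] in [s] and following [d] afterwards,
   and [e] is greedy for it. *)
pose q (s : S) (a : A) := \sum_s' P (s, a) s' * (r s a s' + gamma * val d s').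
pose e : {ffun S -> A} := [ffun s => [arg max_(a > point) q s a]%O].
have qe t a : q t a <= q t (e t).
  by rewrite ffunE; case: arg_maxP => // b _; exact.
have backup_e t : backup r gamma P (deterministic e t) (val d) t = q t (e t).
  rewrite /backup (bigD1 (e t))//= /deterministic eqxx mul1r.
  rewrite [X in _ + X]big1 ?addr0//.
  by move=> a /negbTE ->; rewrite mul0r.
have backup_le p t : prob_dist p -> backup r gamma P p (val d) t <= q t (e t).
  move=> [p0 p1]; rewrite -[leRHS]mul1r -p1 mulr_suml; apply: ler_sum => a _.
  by rewrite ler_wpM2l ?qe.
have de t : val d t <= val e t.
  apply: value_ge => //; first exact: stationary_history (deterministic_dist e).
  move=> _ t'; rewrite backup_e -{1}[val d t']dbk.
  by apply: backup_le; exact: deterministic_dist.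
have valE t : val e t = val d t.
  apply/eqP; rewrite -subr_eq0; apply/eqP.
  apply: (psumr_eq0P (P := predT) (F := fun t => val e t - val d t)) => //.
    by move=> t' _; rewrite subr_ge0.
  have sum_le : \sum_t val e t <= \sum_t val d t := dmax e isT.
  apply/le_anti; rewrite sumrB subr_le0 sum_le andTb -sumrB.
  by apply: sumr_ge0 => t' _; rewrite subr_ge0.
rewrite -/(val d) (le_trans (backup_le _ _ _))//.
rewrite -backup_e -valE -[leRHS](value_backup r s' HP (deterministic_dist e)).
by rewrite (_ : value _ _ _ _ = val d)//; apply/funext => t; exact: valE.
Qed.

End stationary.

(** * Semicontinuity of the objective *)

(** Stationary policies carry the product topology of R^(S x A), in which they
    form a compact set. *)
Local Notation policy_space S A R := {ptws S -> {ptws A -> R}}.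

Section semicontinuity.
Context {S A : finPointedType} {R : realType}.
Variables (r : S -> A -> S -> R) (gamma : R) (mu : S -> R).
Hypothesis gamma01 : 0 < gamma < 1.
Hypothesis Hmu : prob_dist mu.
Implicit Types (P : kernel_space S A R) (sigma : S -> A -> R).

Let gamma_lt1 : 0 < 1 - gamma.
Proof. by rewrite subr_gt0; case/andP: gamma01. Qed.

Lemma backupD P p v c s : transition_kernels S A R P -> prob_dist p ->
  backup r gamma P p (fun s => v s + c) s = backup r gamma P p v s + gamma * c.
Proof.
move=> HP [_ p1]; rewrite /backup -[gamma * c]mul1r -p1 mulr_suml -[RHS]big_split.
apply: eq_bigr => a _ /=; rewrite -mulrDr; congr (_ * _).
have [_ P1] := HP (s, a).
rewrite -[gamma * c]mul1r -P1 mulr_suml -[RHS]big_split.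
by apply: eq_bigr => s' _ /=; ring.
Qed.

(** A constant added to [v] is discounted by the backup, which leaves a margin
    of [1 - gamma] times that constant for the change of the backup of [v]. *)
Lemma value_perturb_le P sigma v eps s :
  transition_kernels S A R P -> (forall s, prob_dist (sigma s)) ->
  (forall s, backup r gamma P (sigma s) v s <= v s + (1 - gamma) * eps) ->
  value r gamma (fun=> sigma) P s <= v s + eps.
Proof.
move=> HP Hs le; have Hpi := stationary_history Hs.
apply: (value_le gamma01 Hpi HP (w := fun s => v s + eps)) => _ s'.
by rewrite backupD//; have := le s'; lra.
Qed.

Lemma value_perturb_ge P sigma v eps s :
  transition_kernels S A R P -> (forall s, prob_dist (sigma s)) ->
  (forall s, v s - (1 - gamma) * eps <= backup r gamma P (sigma s) v s) ->
  v s - eps <= value r gamma (fun=> sigma) P s.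
Proof.
move=> HP Hs ge; have Hpi := stationary_history Hs.
apply: (value_ge gamma01 Hpi HP (w := fun s => v s - eps)) => _ s'.
by rewrite backupD//; have := ge s'; lra.
Qed.

Lemma objective_le pi pi' P P' c :
  (forall s, value r gamma pi P s <= value r gamma pi' P' s + c) ->
  objective r gamma mu pi P <= objective r gamma mu pi' P' + c.
Proof.
have [mu0 mu1] := Hmu; move=> le.
rewrite /objective -[X in _ + X]mul1r -mu1 mulr_suml -big_split.
apply: ler_sum => s _ /=.
by rewrite -mulrDr ler_wpM2l.
Qed.

Lemma eval2_continuous {T T' : finType} (t : T) (t' : T') :
  continuous (fun f : {ptws T -> {ptws T' -> R}} => f t t').
Proof.
move=> f; apply: (@continuous_comp _ _ _
  (fun f : {ptws T -> {ptws T' -> R}} => f t) (fun g : {ptws T' -> R} => g t')).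
  exact: (@proj_continuous T (fun=> {ptws T' -> R}) t).
exact: (@proj_continuous T' (fun=> R) t').
Qed.

Lemma cvg_backup {I : Type} (F : set_system I) {FF : Filter F}
    (P_ : I -> kernel_space S A R) (p_ : I -> A -> R) P p v s :
  (forall x s', P_ i x s' @[i --> F] --> P x s') ->
  (forall a, p_ i a @[i --> F] --> p a) ->
  backup r gamma (P_ i) (p_ i) v s @[i --> F] --> backup r gamma P p v s.
Proof.
move=> cP cp; apply: cvg_big => [|a _]; first exact: add_continuous.
apply: cvgM; first exact: cp.
apply: cvg_big => [|s' _]; first exact: add_continuous.
by apply: cvgMr_tmp; exact: cP.
Qed.

Lemma backup_kernel_continuous p v s :
  continuous (fun P => backup r gamma P p v s).
Proof.
move=> P; apply: (@cvg_backup _ (nbhs P)) => [x s'|a]; last exact: cvg_cst.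
exact: (@eval2_continuous (S * A)%type S x s').
Qed.

Lemma backup_policy_continuous P v s :
  continuous (fun sigma : policy_space S A R => backup r gamma P (sigma s) v s).
Proof.
move=> sigma; apply: (@cvg_backup _ (nbhs sigma)) => [x s'|a].
  exact: cvg_cst.
exact: eval2_continuous.
Qed.

Lemma objective_kernel_lsc sigma P a :
  (forall s, prob_dist (sigma s)) -> transition_kernels S A R P ->
  a < objective r gamma mu (fun=> sigma) P ->
  \forall P' \near P, transition_kernels S A R P' ->
    a < objective r gamma mu (fun=> sigma) P'.
Proof.
move=> Hs HP aP; pose v := value r gamma (fun=> sigma) P.
pose eps := (objective r gamma mu (fun=> sigma) P - a) / 2.
have eps0 : 0 < eps by rewrite divr_gt0// subr_gt0.
have close s : \forall P' \near P,
    v s - (1 - gamma) * eps < backup r gamma P' (sigma s) v s.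
  apply: cvgr_gt (@backup_kernel_continuous (sigma s) v s P) _ _.
  by rewrite value_backup// ltrBlDr ltrDl mulr_gt0.
apply: filterS (filter_forall _ close) => P' near HP'.
have : objective r gamma mu (fun=> sigma) P <=
    objective r gamma mu (fun=> sigma) P' + eps.
  apply: objective_le => s; rewrite -lerBlDr.
  by apply: value_perturb_ge => // s'; rewrite ltW.
by rewrite /eps; lra.
Qed.

Lemma objective_policy_usc (sigma : policy_space S A R) P a :
  (forall s, prob_dist (sigma s)) -> transition_kernels S A R P ->
  objective r gamma mu (fun=> sigma) P < a ->
  \forall sigma' \near sigma, (forall s, prob_dist (sigma' s)) ->
    objective r gamma mu (fun=> sigma') P < a.
Proof.
move=> Hs HP aP; pose v := value r gamma (fun=> sigma) P.
pose eps := (a - objective r gamma mu (fun=> sigma) P) / 2.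
have eps0 : 0 < eps by rewrite divr_gt0// subr_gt0.
have close s : \forall sigma' \near sigma,
    backup r gamma P (sigma' s) v s < v s + (1 - gamma) * eps.
  apply: cvgr_lt (@backup_policy_continuous P v s sigma) _ _.
  by rewrite value_backup// ltrDl mulr_gt0.
apply: (@filterS _ _ (nbhs_filter sigma) _ _ _
  (filter_forall (nbhs_filter sigma) close)) => sigma' near Hs'.
have : objective r gamma mu (fun=> sigma') P <=
    objective r gamma mu (fun=> sigma) P + eps.
  apply: objective_le => s.
  by apply: value_perturb_le => // s'; rewrite ltW.
by rewrite /eps; lra.
Qed.

End semicontinuity.

(** * Attainment of extrema *)

(** Semicontinuity is required only along [K], since the objective means nothing
    at functions that are not families of probability distributions. *)
Lemma compact_attains_max {T : topologicalType} {R : realType} (K : set T)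
    (g : T -> R) :
  compact K -> K !=set0 ->
  (forall x a, K x -> g x < a -> \forall y \near x, K y -> g y < a) ->
  exists c, is_max K g c.
Proof.
move=> /compact_near_coveringP/near_covering_withinP cK [x0 Kx0] usc.
apply: contrapT => nomax.
have above x : K x -> exists2 y, K y & g x < g y.
  move=> Kx; apply: contrapT => nab; apply: nomax; exists (g x).
  split; first by exists x.
  by move=> y Ky; rewrite leNgt; apply/negP => gxy; apply: nab; exists y.
(* If there is no maximum, every point [x] of [K] has a neighborhood on which
   [g] stays below the value at some point of [K]; by compactness one point of [K]
   then lies strictly above all of [K], itself included.  [F] is the filter of
   the points of [K] at which [g] is large. *)
pose F := filter_from K (fun x => [set y | K y /\ g x <= g y]).
have FF : Filter F.
  apply: filter_from_filter; first by exists x0.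
  move=> x y Kx Ky; have [gxy|/ltW gyx] := leP (g x) (g y).
    by exists y => // z [Kz yz]; do 2!split => //; exact: le_trans yz.
  by exists x => // z [Kz xz]; do 2!split => //; exact: le_trans xz.
have [|x Kx near] := cK T F (fun y x => g x < g y) FF.
  move=> x Kx; have [y Ky xy] := above x Kx.
  exists ([set x' | K x' -> g x' < g y], [set z | K z /\ g y <= g z]).
    by split; [exact: usc|exists y].
  by move=> [x' z] [/= lt [_ yz]] Kx'; exact: lt_le_trans (lt Kx') yz.
have /near/(_ _ Kx) : K x /\ g x <= g x by [].
by rewrite ltxx.
Qed.

Lemma prob_dist_compact {E : finType} {R : realType} :
  compact (prob_dist : set {ptws E -> R}).
Proof.
apply: (@subclosed_compact _ _
  [set f : {ptws E -> R} | forall e, `[0, 1]%classic (f e)]).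
- rewrite (_ : prob_dist = \bigcap_e [set p : {ptws E -> R} | 0 <= p e] `&`
     [set p | \sum_e p e = 1]); last first.
    apply/seteqP; split=> p [p0 p1]; split=> // e; last exact: p0.
    by move=> _; exact: p0.
  apply: closedI.
    apply: closed_bigI => e _.
    apply: (@preimage_closed _ _ (fun p : {ptws E -> R} => p e)
      [set x | 0 <= x]); last exact: closed_ge.
    by move=> p _; exact: (@proj_continuous E (fun=> R) e).
  apply: (@preimage_closed _ _ (fun p : {ptws E -> R} => \sum_e p e)
    [set x | x = 1]); last exact: closed_eq.
  move=> p _; apply: (@cvg_big R E +%R 0 predT (@add_continuous R^o) _ (nbhs p)
    (index_enum E) (fun e q => q e) (fun e => p e) (nbhs_filter p)) => e _.
  exact: (@proj_continuous E (fun=> R) e).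
- apply: (@tychonoff E (fun=> R) (fun=> `[0, 1]%classic)) => e.
  exact: segment_compact.
- move=> p [p0 p1] e; rewrite /= in_itv/= p0 /= -p1 (bigD1 e)//= lerDl.
  exact: sumr_ge0.
Qed.

Lemma policies_compact {S A : finType} {R : realType} :
  compact [set sigma : policy_space S A R | forall s, prob_dist (sigma s)].
Proof.
apply: (@tychonoff S (fun=> {ptws A -> R}) (fun=> prob_dist)) => s.
exact: prob_dist_compact.
Qed.

(** * Minimax *)

Section extrema.
Context {X Y : Type} {R : realType}.

Lemma is_max_min_sup_inf (U : set X) (V : set Y) (f : X -> Y -> R) c :
  is_max_min U V f c -> sup_inf U V f = c%:E.
Proof.
move=> [g gmin [[x Ux gx] gmax]].
have infE z : U z -> ereal_inf [set (f z y)%:E | y in V] = (g z)%:E.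
  move=> /gmin [[y Vy fy] le]; apply/le_anti/andP; split.
    by apply: ereal_inf_lbound; exists y => //; rewrite fy.
  by apply: le_ereal_inf_tmp => _ [y' Vy' <-]; rewrite lee_fin le.
apply/le_anti/andP; split.
  by apply: ge_ereal_sup => _ [z Uz <-]; rewrite infE// lee_fin gmax.
by apply: ereal_sup_ubound; exists x => //; rewrite infE// gx.
Qed.

Lemma sup_inf_le_inf_sup (U : set X) (V : set Y) (f : X -> Y -> R) :
  (sup_inf U V f <= inf_sup U V f)%E.
Proof.
apply: ge_ereal_sup => _ [x Ux <-]; apply: le_ereal_inf_tmp => _ [y Vy <-].
apply: (@le_trans _ _ (f x y)%:E); first by apply: ereal_inf_lbound; exists y.
by apply: ereal_sup_ubound; exists x.
Qed.

End extrema.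

Theorem lemma1 (R : realType) (S A : finPointedType)
  (U : set (kernel_space S A R)) (r : S -> A -> S -> R) (gamma : R)
  (mu : S -> R) :
  U `<=` transition_kernels S A R -> U !=set0 -> compact U ->
  0 < gamma < 1 -> prob_dist mu ->
  sup_inf (stationary_policies S A R) U (objective r gamma mu) =
    inf_sup (stationary_policies S A R) U (objective r gamma mu) ->
  exists2 c : R,
    is_max_min (stationary_policies S A R) U (objective r gamma mu) c &
    sup_inf (history_policies S A R) U (objective r gamma mu) = c%:E.
Proof.
move=> UP U0 cU gamma01 Hmu duality.
pose obj := objective r gamma mu.
have minP pi : exists m, stationary_policies S A R pi -> is_min U (obj pi) m.
  have [|nst] := pselect (stationary_policies S A R pi); last by exists 0.
  move=> [sigma Hs <-].
  have [|m [[P UPP mE] mmax]] :=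
    @compact_attains_max _ _ U (fun P => - obj (fun=> sigma) P) cU U0.
    move=> P a UPP; rewrite ltrNl => aP.
    apply: filterS (objective_kernel_lsc gamma01 Hmu Hs (UP _ UPP) aP).
    move=> P' H UP'.
    by rewrite ltrNl H//; exact: UP.
  exists (- m) => _; split; first by exists P => //; rewrite -mE opprK.
  by move=> P' /mmax; rewrite lerNl.
have [g gmin] := choice minP.
pose St := [set sigma : policy_space S A R | forall s, prob_dist (sigma s)].
have St0 : St !=set0.
  by exists (deterministic (fun=> point)) => s; exact: deterministic_dist.
have [|c [[sigma Hs gc] gmax]] := @compact_attains_max _ _ St
    (fun sigma => g (fun=> sigma)) policies_compact St0.
  move=> sigma a Hs ga.
  have [[P UPP PE] _] := gmin (fun=> sigma) (ex_intro2 _ _ sigma Hs erefl).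
  (* An infimum of upper semicontinuous functions is upper semicontinuous: near
     [sigma], the kernel that is worst for [sigma] keeps the minimum below [a]. *)
  rewrite -PE in ga.
  apply: (@filterS _ _ (nbhs_filter sigma) _ _ _
    (objective_policy_usc gamma01 Hmu Hs (UP _ UPP) ga)) => sigma' H Hs'.
  have [_ le] := gmin (fun=> sigma') (ex_intro2 _ _ sigma' Hs' erefl).
  exact: le_lt_trans (le _ UPP) (H Hs').
have maxmin : is_max_min (stationary_policies S A R) U obj c.
  exists g; first by move=> pi Hpi; exact: gmin.
  split; first by exists (fun=> sigma) => //; exists sigma.
  by move=> _ [sigma' Hs' <-]; exact: gmax.
exists c => //; have supE := is_max_min_sup_inf maxmin.
rewrite -supE; apply/le_anti/andP; split; last first.
  apply: ereal_sup_le => _ [pi [tau Ht <-] <-].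
  by exists (fun=> tau) => //; exact: stationary_history.
rewrite [X in (_ <= X)%E]duality; apply: le_trans (sup_inf_le_inf_sup _ _ _) _.
apply: le_ereal_inf_tmp => _ [P UPP <-].
apply: le_trans (ereal_inf_lbound _) _; first by exists P.
apply: ge_ereal_sup => _ [pi Hpi <-].
have [d dopt] := exists_optimal_deterministic gamma01 r (UP _ UPP).
apply: (@le_trans _ _ (obj (fun=> deterministic d) P)%:E).
  rewrite lee_fin -[leRHS]addr0; apply: objective_le => // s.
  by rewrite addr0 dopt.
apply: ereal_sup_ubound; exists (fun=> deterministic d) => //.
by exists (deterministic d) => // s; exact: deterministic_dist.
Qed.
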